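(* Let $T : L^1(\mathbb{R}) \to C^b(\mathbb{R})$ be an integral transform $$T(f)(y) = \int_{\mathbb{R}} K(x,y) f(x)\, dx \qquad (f\in L^1(\mathbb{R}),\ y\in\mathbb{R}),$$ whose kernel $K \in C^b(\mathbb{R}\times\mathbb{R})$ is differentiable with respect to the first variable. Suppose that (i) (time differentiation property) $T(f')(y) = 2\pi i y\, T(f)(y)$ for every $f \in C_c^1(\mathbb{R})$ and every $y\in\mathbb{R}$; and (ii) (Dirac delta property) there exists a Dirac delta sequence $(\delta_n)\subset C_c^1(\mathbb{R})$ such that $\lim_{n\to\infty} T(\delta_n)(y) = 1$ for every $y\in\mathbb{R}$. Then $T$ is the Fourier transform, i.e. $$T(f)(y) = \int_{\mathbb{R}} f(x) e^{-2\pi i x y}\, dx$$ for every $f\in L^1(\mathbb{R})$ and $y\in\mathbb{R}$.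
   Context: $C^b(X)$ denotes the Banach space of complex-valued, continuous, bounded functions on $X$ (here $X=\mathbb{R}$ or $X = \mathbb{R}\times\mathbb{R}$); $C_c^1(\mathbb{R})$ is the vector space of complex-valued, compactly supported $C^1$ functions on $\mathbb{R}$; $L^1(\mathbb{R})$ is the Banach space of complex-valued integrable functions on $\mathbb{R}$. A sequence $(\delta_n)_{n\ge 1}\subset C_c^1(\mathbb{R})$ is called a Dirac delta sequence if every $\delta_n$ has compact support contained in $[-\frac1n,\frac1n]$, is nonnegative and symmetric (i.e. $\delta_n(x)=\delta_n(-x)$ for every $x\in\mathbb{R}$), and satisfies $\int_{\mathbb{R}}\delta_n(x)\,dx = 1$. *)

(* Defs.v *)
From HB Require Import structures.
From mathcomp Require Import all_boot all_order all_algebra.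
From mathcomp Require Import complex.
From mathcomp Require Import all_classical all_reals all_analysis.

Set Implicit Arguments.
Unset Strict Implicit.
Unset Printing Implicit Defensive.

Import Order.TTheory GRing.Theory Num.Theory.
Import numFieldNormedType.Exports.

Local Open Scope classical_set_scope.
Local Open Scope ring_scope.

(* The complex numbers are taken as [Rcomplex R], the copy of [R[i]] that is an
   algebra over [R] with the [R]-valued modulus as norm.  The instances below
   equip it with the topology of that norm, so that limits, continuity,
   boundedness and derivatives of functions [R -> Rcomplex R] are the generic
   ones for normed modules over [R]. *)
Section Rcomplex_normedModType.
Variable R : rcfType.

HB.instance Definition _ :=
  PseudoMetric.copy (Rcomplex R) (pseudoMetric_normed (Rcomplex R)).

HB.instance Definition _ := isPointed.Build (Rcomplex R) 0.

HB.instance Definition _ :=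
  NormedZmod_PseudoMetric_eq.Build R (Rcomplex R) erefl.

Lemma Rcomplex_normrZ (a : R) (z : Rcomplex R) : `|a *: z| = `|a| * `|z|.
Proof.
case: z => x y; rewrite /Num.norm/=.
by rewrite !exprMn -mulrDr Num.Theory.sqrtrM ?sqr_ge0// Num.Theory.sqrtr_sqr.
Qed.

HB.instance Definition _ :=
  PseudoMetricNormedZmod_Lmodule_isNormedModule.Build R (Rcomplex R)
    Rcomplex_normrZ.

End Rcomplex_normedModType.

Section complex_valued_functions.
Variable R : realType.
Local Notation C := (Rcomplex R).
Local Notation mu := (@lebesgue_measure R).

Definition Ci : C := Complex 0 1.

Definition cexp (z : C) : C :=
  expR (complex.Re z) *: (Complex (cos (complex.Im z)) (sin (complex.Im z)) : C).

Definition Cb (X : topologicalType) (f : X -> C) : Prop :=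
  continuous f /\ bounded_fun f.

Definition tsupport (f : R -> C) : set R := closure [set x | f x != 0].

Definition C1c (f : R -> C) : Prop :=
  [/\ forall x, derivable f x 1, continuous (derive1 f) & compact (tsupport f)].

(* Elements of the Banach space L^1 are handled through representatives. *)
Definition L1 (f : R -> C) : Prop :=
  mu.-integrable setT (fun x => (complex.Re (f x))%:E) /\
  mu.-integrable setT (fun x => (complex.Im (f x))%:E).

Definition cintegral (f : R -> C) : C :=
  Complex (\int[mu]_x complex.Re (f x)) (\int[mu]_x complex.Im (f x)).

(* Sequences are indexed by n >= 1; the value at n = 0 is irrelevant. *)
Definition dirac_delta_seq (delta : nat -> R -> C) : Prop :=
  forall n, (0 < n)%N ->
  [/\ C1c (delta n),
      tsupport (delta n) `<=` `[- n%:R^-1, n%:R^-1],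
      forall x, complex.Im (delta n x) = 0 /\ 0 <= complex.Re (delta n x),
      forall x, delta n x = delta n (- x) &
      cintegral (delta n) = 1].

End complex_valued_functions.

Arguments Ci {R}.

(* Main.v *)
(* Fix [y] and put [k x = K (x, y)], [th = 2 pi y].  The differentiation property
   says that [k' = - i th k] weakly, so [h x = k x * exp (i th x)] is orthogonal
   to the derivative of every compactly supported C^1 function.  Taking such
   derivatives of the form [delta_n (x - a) - delta_n (x - b)] and letting [n]
   tend to infinity gives [h a = h b], so [h] is constant; the Dirac delta
   property says [h 0 = k 0 = 1]. *)

Require Import Defs.
From HB Require Import structures.
From mathcomp Require Import all_boot all_order all_algebra.
From mathcomp Require Import complex.
From mathcomp Require Import all_classical all_reals all_analysis.
From mathcomp Require Import ring lra.
Import Order.TTheory GRing.Theory Num.Theory.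
Import numFieldNormedType.Exports.
Set Implicit Arguments.
Unset Strict Implicit.

Local Open Scope classical_set_scope.
Local Open Scope ring_scope.

(** * Calculus of complex-valued functions through real and imaginary parts *)

Lemma continuous_Re (R : realType) : continuous (@complex.Re R : Rcomplex R -> R).
Proof.
move=> z; apply/(@cvgrPdist_le _ _ _ (nbhs z) (nbhs_filter z)) => e e0.
near=> w.
rewrite -raddfB; apply: (@le_trans _ _ `|z - w|); last first.
  by near: w; apply: (@cvgr_dist_le _ (Rcomplex R)).
case: (z - w) => p q; rewrite [leRHS]/Num.norm/= -sqrtr_sqr ler_sqrt.
  by rewrite lerDl sqr_ge0.
by rewrite addr_ge0 ?sqr_ge0.
Unshelve. all: by end_near. Qed.

Lemma continuous_Im (R : realType) : continuous (@complex.Im R : Rcomplex R -> R).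
Proof.
move=> z; apply/(@cvgrPdist_le _ _ _ (nbhs z) (nbhs_filter z)) => e e0.
near=> w.
rewrite -raddfB; apply: (@le_trans _ _ `|z - w|); last first.
  by near: w; apply: (@cvgr_dist_le _ (Rcomplex R)).
case: (z - w) => p q; rewrite [leRHS]/Num.norm/= -sqrtr_sqr ler_sqrt.
  by rewrite lerDr sqr_ge0.
by rewrite addr_ge0 ?sqr_ge0.
Unshelve. all: by end_near. Qed.

(** With a complex number seen as a real combination of the fixed vectors 1 and i, continuity and
    derivatives of [Complex (u x) (v x)] reduce to sums of scalar functions times constant
    vectors. *)
Lemma ComplexE (R : realType) (a b : R) :
  Complex a b = a *: (1 : Rcomplex R) + b *: Ci :> Rcomplex R.
Proof.
by apply/eqP; rewrite eq_complex/= !mulr0 !mulr1 addr0 add0r !eqxx.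
Qed.

Lemma continuous_Complex (R : realType) (u v : R -> R) :
  continuous u -> continuous v ->
  continuous (fun x => Complex (u x) (v x) : Rcomplex R).
Proof.
move=> cu cv x.
rewrite (_ : (fun x => _) = (fun x => u x *: (1 : Rcomplex R) + v x *: Ci)).
  by apply: cvgD; apply: cvgZr_tmp; [exact: cu|exact: cv].
by apply/funext => t; rewrite ComplexE.
Qed.

Lemma is_derive_scalel (R : realType) (V : normedModType R) (u : R -> R) (c : V)
    (x u' : R) :
  is_derive x 1 u u' -> is_derive x 1 (fun t => u t *: c) (u' *: c).
Proof.
move=> [/derivable1_diffP du <-]; rewrite deriveE//.
have D : is_diff x (fun t => u t *: c) (fun h => 'd u x h *: c).
  exact: (@is_diff_comp _ _ _ _ _ _ _ _ _ (differentiableP du)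
    (is_diff_scalel (u x) c)).
apply: DeriveDef; first exact/derivable1_diffP/ex_diff.
by rewrite deriveE ?diff_val//; exact: ex_diff.
Qed.

Lemma is_derive_Complex (R : realType) (u v : R -> R) (x u' v' : R) :
  is_derive x 1 u u' -> is_derive x 1 v v' ->
  is_derive x 1 (fun t => Complex (u t) (v t) : Rcomplex R)
    (Complex u' v' : Rcomplex R).
Proof.
move=> du dv; rewrite ComplexE.
rewrite (_ : (fun x => _) = (fun x => u x *: (1 : Rcomplex R) + v x *: Ci)).
  by apply: is_deriveD; exact: is_derive_scalel.
by apply/funext => t; rewrite ComplexE.
Qed.

Lemma derive_continuous (R : realType) (g dg : R -> R) :
  (forall x : R, is_derive x 1 g (dg x)) -> continuous g.
Proof.
move=> dg' x; apply/differentiable_continuous/derivable1_diffP.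
exact: (@ex_derive _ _ _ _ _ _ _ (dg' x)).
Qed.

(** * Compact support: integrability and topological support *)

Lemma compact_support_integrable (R : realType) (u : R -> R) (a b : R) :
  continuous u -> (forall x, x \notin `[a, b] -> u x = 0) ->
  (@lebesgue_measure R).-integrable setT (EFin \o u).
Proof.
move=> cu u0.
have -> : EFin \o u = (EFin \o u) \_ `[a, b]%classic.
  apply/funext => x; rewrite patchE; case: ifPn => //.
  by rewrite notin_setE/= => /negP /u0 /= ->.
have [+ _] := @integrable_mkcond _ _ _ (@lebesgue_measure R) `[a, b]%classic
  (EFin \o u) (measurable_itv _); apply.
apply: (@continuous_compact_integrable R u); first exact: segment_compact.
exact: continuous_subspaceT.
Qed.

Lemma compact_support_L1 (R : realType) (f : R -> Rcomplex R) (a b : R) :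
  continuous f -> (forall x, x \notin `[a, b] -> f x = 0) -> L1 f.
Proof.
move=> cf f0; split; apply: (@compact_support_integrable _ _ a b).
- by move=> x; apply: (@continuous_comp _ _ _ f); [exact: cf|exact: continuous_Re].
- by move=> x /f0 ->.
- by move=> x; apply: (@continuous_comp _ _ _ f); [exact: cf|exact: continuous_Im].
- by move=> x /f0 ->.
Qed.

Lemma compact_tsupport (R : realType) (f : R -> Rcomplex R) (a b : R) :
  (forall x, x \notin `[a, b] -> f x = 0) -> compact (tsupport f).
Proof.
move=> f0; apply: (@subclosed_compact _ _ `[a, b]%classic).
- exact: closed_closure.
- exact: segment_compact.
- rewrite /tsupport [X in _ `<=` X](closure_id _).1; last exact: itv_closed.
  apply: closureS => x /= fx; apply: contraNT fx => /f0 ->; exact/eqP.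
Qed.

(** * Bumps, approximate identities and functions of zero weak derivative *)

(** The real-valued form of a term of a Dirac delta sequence with a movable centre: the real part of
    [delta n] has centre 0 and radius 1/n, and its translates have the other centres. *)
Definition bump (R : realType) (a r : R) (w : R -> R) : Prop :=
  [/\ continuous w, forall x, 0 <= w x,
      forall x, x \notin `[a - r, a + r] -> w x = 0 &
      \int[@lebesgue_measure R]_x w x = 1].

(** As [w] is nonnegative and vanishes off the interval, (c - e) w <= u w <= (c + e) w holds on the
    whole line; integrate and use that [w] has mass 1. *)
Lemma weighted_mean_dist (R : realType) (u w : R -> R) (a r c e : R) :
  continuous u -> bump a r w ->
  (forall x, x \in `[a - r, a + r] -> `|u x - c| <= e) ->
  `|\int[@lebesgue_measure R]_x (u x * w x) - c| <= e.
Proof.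
move=> cu [cw w0 ws w1] uc.
have iw := compact_support_integrable cw ws.
have iuw : (@lebesgue_measure R).-integrable setT (EFin \o (fun x => u x * w x)).
  apply: (@compact_support_integrable _ _ (a - r) (a + r)).
    by move=> x; apply: cvgM; [exact: cu|exact: cw].
  by move=> x /ws ->; rewrite mulr0.
have iz (t : R) : (@lebesgue_measure R).-integrable setT (EFin \o (fun x => t * w x)).
  apply: (@compact_support_integrable _ _ (a - r) (a + r)).
    by move=> x; apply: cvgM; [exact: cvg_cst|exact: cw].
  by move=> x /ws ->; rewrite mulr0.
have bound x : (c - e) * w x <= u x * w x <= (c + e) * w x.
  have [/uc|/ws ->] := boolP (x \in `[a - r, a + r]); last by rewrite !mulr0 lexx.
  rewrite ler_norml => /andP[h1 h2].
  by apply/andP; split; apply: ler_wpM2r => //; lra.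
have lo : c - e <= \int[@lebesgue_measure R]_x (u x * w x).
  rewrite -[leLHS]mulr1 -w1 -RintegralZl//; apply: le_Rintegral => //.
  by move=> x _; case/andP: (bound x).
have hi : \int[@lebesgue_measure R]_x (u x * w x) <= c + e.
  rewrite -[leRHS]mulr1 -w1 -RintegralZl//; apply: le_Rintegral => //.
  by move=> x _; case/andP: (bound x).
by rewrite ler_norml; apply/andP; split; lra.
Qed.

(** Continuity of [u] at [a] gives a radius [d] within which [u] stays [e]-close to [u a]; once 1/n
    < d the support of [w n] lies inside that radius and [weighted_mean_dist] applies. *)
Lemma approximate_identity (R : realType) (u : R -> R) (w : nat -> R -> R) (a : R) :
  continuous u ->
  (forall n, (0 < n)%N -> bump a n%:R^-1 (w n)) ->
  \int[@lebesgue_measure R]_x (u x * w n x) @[n --> \oo] --> u a.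
Proof.
move=> cu Hw; apply/cvgrPdist_le => e e0.
have /cvgrPdist_le/(_ _ e0) /nbhs_ballP[d /= d0 dP] := cu a.
near=> n.
have n0 : (0 < n)%N by near: n; exists 1%N.
have nd : n%:R^-1 < d.
  rewrite invf_plt ?posrE ?ltr0n//.
  by near: n; exact: nbhs_infty_gtr.
rewrite distrC; apply: (weighted_mean_dist cu (Hw n n0)) => x.
rewrite in_itv/= => /andP[h1 h2]; rewrite distrC; apply: dP.
by rewrite /ball/= ltr_norml; apply/andP; split; lra.
Unshelve. all: by end_near. Qed.

(** Being constant on each side of the support, [G] makes compactly supported test functions
    possible: two translates of [G] differ only on a bounded set. *)
Lemma bump_antiderivative (R : realType) (w : R -> R) (r : R) :
  bump 0 r w ->
  exists G : R -> R, [/\ forall x : R, is_derive x 1 G (w x),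
    forall x : R, x < - r -> G x = 0 & forall x : R, r <= x -> G x = 1].
Proof.
case; rewrite sub0r add0r => cw _ ws w1.
have iw := compact_support_integrable cw ws.
exists (fun x => \int[@lebesgue_measure R]_(t in `]-oo, x]) w t); split => x.
(* The point [x + 1] is just some bound beyond [x], up to which [w] must be integrable. *)
- have [||//|] := @continuous_FTC1 R w (BInfty R true) x (x + 1) _ _ _ (cw x).
  + by rewrite ltrDl.
  + exact: integrableS iw.
  + by rewrite ltNyr.
  + by move=> dG <-; rewrite derive1E; exact/derivableP.
- move=> xr; rewrite (@eq_Rintegral _ _ _ _ _ (cst 0)).
    by rewrite Rintegral_cst// mul0r.
  move=> t /set_mem/=; rewrite in_itv/= => tx; apply: ws.
  by rewrite in_itv/= negb_and -ltNge (le_lt_trans tx xr).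
- move=> rx; rewrite -w1 Rintegral_mkcond; apply: eq_Rintegral => t _.
  rewrite patchE; case: ifPn => //; rewrite notin_setE/= in_itv/= => /negP.
  rewrite -ltNge => xt; rewrite ws// in_itv/= negb_and.
  by rewrite -(ltNge r t) (le_lt_trans rx xt) orbT.
Qed.

Lemma is_derive_shift_sub (R : realType) (G : R -> R) (a x d : R) :
  is_derive (x - a) 1 G d -> is_derive x 1 (fun t => G (t - a)) d.
Proof.
move=> dG; have Hs : is_derive x 1 (fun t => t - a) 1.
  by rewrite -[X in is_derive _ _ _ X]subr0; apply: is_deriveB.
by rewrite -[d]mulr1; exact: (@is_derive1_comp R G (fun t => t - a) x d 1 dG Hs).
Qed.

(** Only the total mass takes work. It is computed from the antiderivative G(x - a), whose increment
    across the translated support is 1 - 0. *)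
Lemma bump_translate (R : realType) (w : R -> R) (r a : R) :
  0 < r -> bump 0 r w -> bump a r (fun x => w (x - a)).
Proof.
move=> r0 wb; have [cw w0 ws w1] := wb.
have [G [dG G0 G1]] := bump_antiderivative wb.
have dGa x := @is_derive_shift_sub R G a x _ (dG (x - a)).
have cwa : continuous (fun x => w (x - a)).
  by move=> x; apply: (@continuous_comp _ _ _ (fun x => x - a) w);
    [apply: cvgB; [exact: cvg_id|exact: cvg_cst]|exact: cw].
have cGa : continuous (fun x => G (x - a)).
  exact: derive_continuous dGa.
have wsa x : x \notin `[a - r, a + r] -> w (x - a) = 0.
  move=> h; apply: ws; apply: contra h; rewrite !in_itv/= => /andP[? ?].
  by apply/andP; split; lra.
split=> //.
(* The left end is moved one unit further out because [G] is known to vanish only strictly below -r,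
   whereas it equals 1 already at r. *)
have ab : a - r - 1 < a + r by lra.
have FTC : (\int[lebesgue_measure]_(x in `[(a - r - 1)%R, (a + r)%R]) (w (x - a)%R)%:E =
    (G (a + r - a)%R)%:E - (G (a - r - 1 - a)%R)%:E)%E.
  apply: (continuous_FTC2 (F := fun x => G (x - a))) => //.
  - exact: continuous_subspaceT.
  - split.
    + by move=> x _; exact: (@ex_derive _ _ _ _ _ _ _ (dGa x)).
    + exact/cvg_at_right_filter/cGa.
    + exact/cvg_at_left_filter/cGa.
  - by move=> x _; rewrite derive1E (@derive_val _ _ _ _ _ _ _ (dGa x)).
rewrite -EFinB G1 in FTC; last by lra.
rewrite G0 ?subr0 in FTC; last by lra.
transitivity (\int[@lebesgue_measure R]_(x in `[a - r - 1, a + r]) w (x - a)).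
  rewrite [RHS]Rintegral_mkcond; apply: eq_Rintegral => t _.
  rewrite patchE; case: ifPn => //; rewrite notin_setE/= => /negP h.
  apply: wsa; apply: contra h; rewrite !in_itv/= => /andP[? ?].
  by apply/andP; split; lra.
by rewrite /Rintegral FTC.
Qed.

(** The test function is G(x - a) - G(x - b), with [G] the antiderivative of [w n]: it is 0 - 0 far
    to the left and 1 - 1 far to the right. Hence for n >= 1 the means of [u] against the two
    translates of [w n] coincide, while they tend to [u a] and [u b]. *)
Lemma eq_of_orthogonal_to_derivatives (R : realType) (u : R -> R)
    (w : nat -> R -> R) :
  continuous u ->
  (forall n, (0 < n)%N -> bump 0 n%:R^-1 (w n)) ->
  (forall (g dg : R -> R) (c : R), (forall x : R, is_derive x 1 g (dg x)) ->
    continuous dg -> (forall x, x \notin `[- c, c] -> g x = 0) ->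
    (forall x, x \notin `[- c, c] -> dg x = 0) ->
    \int[@lebesgue_measure R]_x (u x * dg x) = 0) ->
  forall a b, u a = u b.
Proof.
move=> cu Hw orth a b.
have r0 n : (0 < n)%N -> 0 < n%:R^-1 :> R by rewrite invr_gt0 ltr0n.
have Hwt c n (n0 : (0 < n)%N) := bump_translate c (r0 n n0) (Hw n n0).
have Ia := approximate_identity cu (Hwt a).
have Ib := approximate_identity cu (Hwt b).
have iu c n : (0 < n)%N ->
    (@lebesgue_measure R).-integrable setT (EFin \o (fun x => u x * w n (x - c))).
  move=> /(Hwt c)[cw _ ws _].
  apply: (@compact_support_integrable _ _ (c - n%:R^-1) (c + n%:R^-1)).
    by move=> x; apply: cvgM; [exact: cu|exact: cw].
  by move=> x /ws ->; rewrite mulr0.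
apply: (cvg_unique _ Ia) => //.
apply: cvg_trans Ib; apply: near_eq_cvg; near=> n.
have n0 : (0 < n)%N by near: n; exists 1%N.
have [_ _ ws _] := Hw n n0.
have [G [dG G0 G1]] := bump_antiderivative (Hw n n0).
(* Outside [-c, c] the points x - a and x - b lie beyond the support of [w n] on the same side, so
   both values of [G] are 0 or both are 1. *)
pose c := `|a| + `|b| + n%:R^-1 + 1.
have [? ?] : - `|a| <= a /\ a <= `|a|.
  by rewrite lerNl -{1}normrN !ler_norm.
have [? ?] : - `|b| <= b /\ b <= `|b|.
  by rewrite lerNl -{1}normrN !ler_norm.
have ? := normr_ge0 a; have ? := normr_ge0 b; have ? := r0 n n0.
apply/esym/eqP; rewrite -subr_eq0 -RintegralB ?iu//; apply/eqP.
transitivity (\int[@lebesgue_measure R]_x (u x * (w n (x - a) - w n (x - b)))).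
  by apply: eq_Rintegral => x _; rewrite mulrBr.
apply: (orth (fun x => G (x - a) - G (x - b)) _ c) => [x|||].
- by apply: is_deriveB; exact: is_derive_shift_sub.
- have [ca _ _ _] := Hwt a n n0; have [cb _ _ _] := Hwt b n n0.
  by move=> x; apply: cvgB; [exact: ca|exact: cb].
- move=> x; rewrite in_itv/= negb_and -!ltNge => /orP[xc|cx].
    by rewrite !G0 ?subrr; rewrite /c in xc; lra.
  by rewrite !G1 ?subrr; rewrite /c in cx; lra.
- move=> x xc; rewrite !ws ?subrr//; apply: contra xc; rewrite !in_itv/= => /andP[? ?];
    by apply/andP; split; rewrite /c; lra.
Unshelve. all: by end_near. Qed.

(** * Complex products and derivatives of the modulating factors *)

Lemma two_pi_Ci_scalar (R : realType) (t : R) :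
  2 * pi%:A * Ci * t%:A = Complex 0 (2 * pi * t) :> Rcomplex R.
Proof.
rewrite mulrC mulr_algl -mulrA mulr_algl mulr_natl scalerMnl scalerA ComplexE.
by rewrite scale0r add0r; congr (_ *: _); ring.
Qed.

Lemma ReM (R : realType) (z t : Rcomplex R) :
  complex.Re (z * t) = complex.Re z * complex.Re t - complex.Im z * complex.Im t.
Proof. by case: z; case: t. Qed.

Lemma ImM (R : realType) (z t : Rcomplex R) :
  complex.Im (z * t) = complex.Re z * complex.Im t + complex.Im z * complex.Re t.
Proof. by case: z; case: t. Qed.

Lemma is_derive_cosM (R : realType) (th x : R) :
  is_derive x 1 (fun t => cos (th * t)) (- (th * sin (th * x))).
Proof.
have H : is_derive x 1 (fun t : R => th * t) th.
  by rewrite -[X in is_derive _ _ _ X]mulr1; exact: is_deriveZ.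
have := @is_derive1_comp R cos _ x _ _ (is_derive_cos (th * x)) H.
by rewrite mulNr mulrC.
Qed.

Lemma is_derive_sinM (R : realType) (th x : R) :
  is_derive x 1 (fun t => sin (th * t)) (th * cos (th * x)).
Proof.
have H : is_derive x 1 (fun t : R => th * t) th.
  by rewrite -[X in is_derive _ _ _ X]mulr1; exact: is_deriveZ.
have := @is_derive1_comp R sin _ x _ _ (is_derive_sin (th * x)) H.
by rewrite mulrC.
Qed.

(** * Test functions and the modulated weak equation *)

Lemma C1c_support (R : realType) (h : R -> Rcomplex R) : C1c h ->
  exists a b, forall x, x \notin `[a, b] -> h x = 0.
Proof.
case=> _ _ /compact_bounded[M [_ hM]].
(* Boundedness provides a bound by every real strictly above [M], hence the choice of M + 1. *)
exists (- (M + 1)), (M + 1) => x; apply: contraNeq => hx.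
by rewrite in_itv/= -ler_norml; apply: hM; [rewrite ltrDl|exact: subset_closure].
Qed.

(** The complement of a closed interval is open, so [h] agrees with 0 near each point of it, and the
    derivative is local. *)
Lemma derive1_support (R : realType) (h : R -> Rcomplex R) (a b : R) :
  (forall x, x \notin `[a, b] -> h x = 0) ->
  forall x, x \notin `[a, b] -> derive1 h x = 0.
Proof.
move=> h0 x xab; rewrite derive1E (near_eq_derive (g := cst 0)) ?derive_cst//.
have : nbhs x (~` `[a, b]%classic).
  apply: open_nbhs_nbhs; split; last exact/negP.
  by apply: closed_openC; exact: itv_closed.
by apply: filterS => t /= /negP /h0.
Qed.

(* [k e] with [e x = cos (th x) + i sin (th x)] has zero weak derivative: test the
   weak equation [k' = - i th k] against [e g]. *)
Lemma modulation_orthogonal (R : realType) (k : R -> Rcomplex R) (th : R)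
    (g dg : R -> R) (c : R) :
  continuous k ->
  (forall f : R -> Rcomplex R, C1c f ->
    cintegral (fun x => k x * derive1 f x) =
    (Complex 0 th : Rcomplex R) * cintegral (fun x => k x * f x)) ->
  (forall x : R, is_derive x 1 g (dg x)) -> continuous dg ->
  (forall x, x \notin `[- c, c] -> g x = 0) ->
  (forall x, x \notin `[- c, c] -> dg x = 0) ->
  let kr x := complex.Re (k x) in let ki x := complex.Im (k x) in
  \int[@lebesgue_measure R]_x
    ((kr x * cos (th * x) - ki x * sin (th * x)) * dg x) = 0 /\
  \int[@lebesgue_measure R]_x
    ((kr x * sin (th * x) + ki x * cos (th * x)) * dg x) = 0.
Proof.
move=> k_cont k_weak g' cdg g0 dg0 kr ki.
have ccos := derive_continuous (is_derive_cosM th).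
have csin := derive_continuous (is_derive_sinM th).
have ckr : continuous kr.
  by move=> x; apply: (@continuous_comp _ _ _ k); [exact: k_cont|exact: continuous_Re].
have cki : continuous ki.
  by move=> x; apply: (@continuous_comp _ _ _ k); [exact: k_cont|exact: continuous_Im].
(* [u] and [v] are the real and imaginary parts of f = e g; [u'] and [v'] are those of f' = e (dg +
   i th g). *)
pose u x := cos (th * x) * g x.
pose v x := sin (th * x) * g x.
pose u' x := cos (th * x) * dg x - th * v x.
pose v' x := sin (th * x) * dg x + th * u x.
have u'P (x : R) : is_derive x 1 u (u' x).
  have := @is_deriveM _ _ _ _ _ _ _ _ (is_derive_cosM th x) (g' x).
  by congr is_derive; rewrite /u' /v /GRing.scale/=; ring.
have v'P (x : R) : is_derive x 1 v (v' x).
  have := @is_deriveM _ _ _ _ _ _ _ _ (is_derive_sinM th x) (g' x).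
  by congr is_derive; rewrite /v' /u /GRing.scale/=; ring.
have cu := derive_continuous u'P.
have cv := derive_continuous v'P.
have cu' : continuous u'.
  move=> x; apply: cvgB; apply: cvgM; [exact: ccos|exact: cdg|exact: cvg_cst|exact: cv].
have cv' : continuous v'.
  move=> x; apply: cvgD; apply: cvgM; [exact: csin|exact: cdg|exact: cvg_cst|exact: cu].
have u0 x : x \notin `[- c, c] -> u x = 0 by move=> /g0 gx; rewrite /u gx mulr0.
have v0 x : x \notin `[- c, c] -> v x = 0 by move=> /g0 gx; rewrite /v gx mulr0.
have u'0 x : x \notin `[- c, c] -> u' x = 0.
  by move=> xc; rewrite /u' dg0// v0// !mulr0 subr0.
have v'0 x : x \notin `[- c, c] -> v' x = 0.
  by move=> xc; rewrite /v' dg0// u0// !mulr0 addr0.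
pose f x : Rcomplex R := Complex (u x) (v x).
have f'P (x : R) : is_derive x 1 f (Complex (u' x) (v' x) : Rcomplex R).
  exact: is_derive_Complex.
have f'E : derive1 f = fun x => Complex (u' x) (v' x).
  by apply/funext => x; rewrite derive1E (@derive_val _ _ _ _ _ _ _ (f'P x)).
have fC : C1c f.
  split.
  - by move=> x; exact: (@ex_derive _ _ _ _ _ _ _ (f'P x)).
  - by rewrite f'E; exact: continuous_Complex.
  - by apply: (@compact_tsupport _ _ (- c) c) => x xc; rewrite /f u0// v0.
(* The real and imaginary parts of k f and k f' all have the form p r + q s, with [p], [q] among
   [kr], [ki], [- ki] and [r], [s] the parts of f or f'. *)
have iM (p q r s : R -> R) : continuous p -> continuous q -> continuous r ->
    continuous s -> (forall x, x \notin `[- c, c] -> r x = 0) ->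
    (forall x, x \notin `[- c, c] -> s x = 0) ->
    (@lebesgue_measure R).-integrable setT (EFin \o (fun x => p x * r x + q x * s x)).
  move=> cp cq cr cs r0 s0; apply: (@compact_support_integrable _ _ (- c) c).
    by move=> x; apply: cvgD; apply: cvgM; [exact: cp|exact: cr|exact: cq|exact: cs].
  by move=> x xc; rewrite r0// s0// !mulr0 addr0.
have iZ (h : R -> R) : (@lebesgue_measure R).-integrable setT (EFin \o h) ->
    (@lebesgue_measure R).-integrable setT (EFin \o (fun x => th * h x)).
  move=> ih; have := @integrableZl _ _ _ (@lebesgue_measure R) setT measurableT th _ ih.
  by apply: eq_integrable.
have cNki : continuous (fun x => - ki x) by move=> x; apply: cvgN; exact: cki.
have /eqP := k_weak _ fC; rewrite f'E eq_complex/= => /andP[/eqP HRe /eqP HIm].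
have ReE (h1 h2 : R -> R) :
    \int[@lebesgue_measure R]_x complex.Re (k x * Complex (h1 x) (h2 x)) =
    \int[@lebesgue_measure R]_x (kr x * h1 x + - ki x * h2 x).
  by apply: eq_Rintegral => x _; rewrite ReM mulNr.
have ImE (h1 h2 : R -> R) :
    \int[@lebesgue_measure R]_x complex.Im (k x * Complex (h1 x) (h2 x)) =
    \int[@lebesgue_measure R]_x (ki x * h1 x + kr x * h2 x).
  by apply: eq_Rintegral => x _; rewrite ImM addrC.
rewrite !ReE !ImE in HRe HIm.
split.
(* Since k e dg = k f' - i th k f, its real part is Re (k f') + th Im (k f), and its imaginary part
   Im (k f') - th Re (k f). The weak equation, split into [HRe] and [HIm], makes both integrals
   vanish. *)
- transitivity (\int[@lebesgue_measure R]_x ((kr x * u' x + - ki x * v' x) +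
      th * (ki x * u x + kr x * v x))).
    by apply: eq_Rintegral => x _; rewrite /u' /v' /u /v; ring.
  rewrite RintegralD ?RintegralZl ?HRe//; [ring|exact: iM| |]; try apply: iZ; exact: iM.
- transitivity (\int[@lebesgue_measure R]_x ((ki x * u' x + kr x * v' x) -
      th * (kr x * u x + - ki x * v x))).
    by apply: eq_Rintegral => x _; rewrite /u' /v' /u /v; ring.
  rewrite RintegralB ?RintegralZl ?HIm//; [ring|exact: iM| |]; try apply: iZ; exact: iM.
Qed.

(** * Identification of the kernel *)

Theorem theorem1 (R : realType)
  (T : (R -> Rcomplex R) -> (R -> Rcomplex R))
  (K : R * R -> Rcomplex R)
  (K_Cb : Cb K)
  (K_diff : forall x y : R, derivable (fun x' : R => K (x', y)) x 1)
  (T_Cb : forall f : R -> Rcomplex R, L1 f -> Cb (T f))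
  (T_int : forall f : R -> Rcomplex R, L1 f -> forall y : R,
     T f y = cintegral (fun x : R => K (x, y) * f x))
  (T_diff : forall f : R -> Rcomplex R, C1c f -> forall y : R,
     T (derive1 f) y = 2 * pi%:A * Ci * y%:A * T f y)
  (T_delta : exists delta : nat -> R -> Rcomplex R,
     dirac_delta_seq delta /\
     forall y : R, T (delta n) y @[n --> \oo] --> (1 : Rcomplex R)) :
  forall f : R -> Rcomplex R, L1 f -> forall y : R,
    T f y =
    cintegral (fun x : R => f x * cexp (- (2 * pi%:A * Ci * x%:A * y%:A))).
Proof.
move=> f fL1 y; rewrite T_int//.
pose k x := K (x, y); pose th := 2 * pi * y.
have k_cont : continuous k.
  by move=> x; apply/differentiable_continuous/derivable1_diffP/K_diff.
have C1c_L1 (h : R -> Rcomplex R) : C1c h -> L1 h /\ L1 (derive1 h).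
  move=> hC; have [a [b hab]] := C1c_support hC; have [dh cdh _] := hC.
  have ch : continuous h.
    by move=> x; exact/differentiable_continuous/derivable1_diffP.
  split; first exact: (compact_support_L1 ch hab).
  exact: (compact_support_L1 cdh (derive1_support hab)).
(* The differentiation property is read through the integral formula for [T], which requires both
   [h] and its derivative to be in [L1]. *)
have k_weak (h : R -> Rcomplex R) : C1c h -> cintegral (fun x => k x * derive1 h x) =
    (Complex 0 th : Rcomplex R) * cintegral (fun x => k x * h x).
  move=> hC; have [hL1 dhL1] := C1c_L1 h hC.
  by rewrite -T_int// -T_int// T_diff// two_pi_Ci_scalar.
have [delta [Hdelta delta_cvg]] := T_delta.
pose w n x := complex.Re (delta n x).
have Hw n : (0 < n)%N -> bump 0 n%:R^-1 (w n).
  move=> n0; have [[dd _ _] ds dpos _ d1] := Hdelta n n0; split.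
  - move=> x; apply: (@continuous_comp _ _ _ (delta n)); last exact: continuous_Re.
    exact/differentiable_continuous/derivable1_diffP.
  - by move=> x; have [_] := dpos x.
  - move=> x; rewrite sub0r add0r; apply: contraNeq => wx; apply: ds;
      apply: subset_closure => /=.
    by apply: contraNneq wx; rewrite /w => ->.
  - by case: d1.
pose kr x := complex.Re (k x); pose ki x := complex.Im (k x).
have ckr : continuous kr.
  by move=> x; apply: (@continuous_comp _ _ _ k); [exact: k_cont|exact: continuous_Re].
have cki : continuous ki.
  by move=> x; apply: (@continuous_comp _ _ _ k); [exact: k_cont|exact: continuous_Im].
(* As [delta n] is real-valued, the two parts of T(delta_n)(y) are the means of [kr] and [ki]
   against the bump [w n]. *)
have T_deltaE n : (0 < n)%N -> T (delta n) y =
    Complex (\int[@lebesgue_measure R]_x (kr x * w n x))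
            (\int[@lebesgue_measure R]_x (ki x * w n x)).
  move=> n0; have [dC _ dpos _ _] := Hdelta n n0.
  rewrite T_int; last by have [] := C1c_L1 _ dC.
  congr Complex; apply: eq_Rintegral => x _; rewrite ?ReM ?ImM.
    by rewrite (dpos x).1 mulr0 subr0.
  by rewrite (dpos x).1 mulr0 add0r.
(* The same sequence of means has limit [kr 0] by the approximate identity and limit Re 1 by the
   Dirac delta property; likewise for [ki 0] below. *)
have kr0 : kr 0 = 1.
  apply: (cvg_unique _ (approximate_identity ckr Hw)) => //.
  have H : complex.Re (T (delta n) y) @[n --> \oo] --> (1 : R).
    by apply: (@cvg_comp _ _ _ _ _ _ _ _ (delta_cvg y)); exact: (@continuous_Re R 1).
  apply: cvg_trans H; apply: near_eq_cvg; near=> n.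
  by rewrite T_deltaE//; near: n; exists 1%N.
have ki0 : ki 0 = 0.
  apply: (cvg_unique _ (approximate_identity cki Hw)) => //.
  have H : complex.Im (T (delta n) y) @[n --> \oo] --> (0 : R).
    by apply: (@cvg_comp _ _ _ _ _ _ _ _ (delta_cvg y)); exact: (@continuous_Im R 1).
  apply: cvg_trans H; apply: near_eq_cvg; near=> n.
  by rewrite T_deltaE//; near: n; exists 1%N.
have ccos := derive_continuous (is_derive_cosM th).
have csin := derive_continuous (is_derive_sinM th).
(* [hr1] and [hi0] are the real and imaginary parts of k(x) exp(i th x) = 1: each part is constant
   in x and is evaluated at 0. *)
have hr1 x : kr x * cos (th * x) - ki x * sin (th * x) = 1.
  rewrite (@eq_of_orthogonal_to_derivatives _
    (fun x => kr x * cos (th * x) - ki x * sin (th * x)) w _ Hw _ x 0).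
  - by rewrite kr0 ki0 mulr0 cos0 mul0r subr0 mulr1.
  - by move=> t; apply: cvgB; apply: cvgM;
      [exact: ckr|exact: ccos|exact: cki|exact: csin].
  - move=> g dg c g' cdg g0 dg0.
    by have [] := modulation_orthogonal k_cont k_weak g' cdg g0 dg0.
have hi0 x : kr x * sin (th * x) + ki x * cos (th * x) = 0.
  rewrite (@eq_of_orthogonal_to_derivatives _
    (fun x => kr x * sin (th * x) + ki x * cos (th * x)) w _ Hw _ x 0).
  - by rewrite kr0 ki0 mulr0 sin0 mul0r addr0 mulr0.
  - by move=> t; apply: cvgD; apply: cvgM;
      [exact: ckr|exact: csin|exact: cki|exact: ccos].
  - move=> g dg c g' cdg g0 dg0.
    by have [] := modulation_orthogonal k_cont k_weak g' cdg g0 dg0.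
(* Cancelling the common factor [f x] leaves the pointwise identity k(x) = exp(-i th x). *)
congr cintegral; apply/funext => x; rewrite mulrC; congr (_ * _).
rewrite two_pi_Ci_scalar [_ * y%:A]mulrC mulr_algl /cexp/= mulr0 oppr0.
rewrite expR0 scale1r cosN sinN.
rewrite (_ : y * (2 * pi * x) = th * x); last by rewrite /th; ring.
have cs := cos2Dsin2 (th * x).
rewrite -[K _]/(k x); apply/eqP; rewrite eq_complex/= -/(kr x) -/(ki x).
have := hr1 x; have := hi0 x; set C := cos _ in cs *; set S := sin _ in cs *.
move=> E1 E2; apply/andP; split; apply/eqP.
(* The equation k e = 1 is solved for k by multiplying by the conjugate C - i S of e, using C^2 +
   S^2 = 1; this is the real part, and the imaginary part follows. *)
- transitivity ((kr x * C - ki x * S) * C + (kr x * S + ki x * C) * S).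
    by rewrite -[LHS]mulr1 -cs; ring.
  by rewrite E1 E2; ring.
- transitivity ((kr x * S + ki x * C) * C - (kr x * C - ki x * S) * S).
    by rewrite -[LHS]mulr1 -cs; ring.
  by rewrite E1 E2; ring.
Unshelve. all: by end_near. Qed.
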